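(* Let $U\ge 1$, $n\ge1$ and $k\ge Un$ be integers. For each user $j=1,\dots,U$ let $\mathbf{L}_j\subseteq M_{n\times k}(\mathbb{C})$ be a lattice of full rank $r=2kn$ (as a lattice in the real vector space $M_{n\times k}(\mathbb{C})\cong\mathbb{R}^{2kn}$) with $\mathbb{Z}$-basis $B_{j,1},\dots,B_{j,r}$, and for a positive integer $N_j$ put $$\mathbf{L}_j(N_j)=\Big\{\sum_{i=1}^r b_iB_{j,i}\;:\; b_i\in\mathbb{Z},\ -N_j\le b_i\le N_j\Big\}.$$ Define $$\mathfrak{D}(N_1,\dots,N_U)=\min_{X_j\in\mathbf{L}_j(N_j)\setminus\{0\},\ j=1,\dots,U}\det(MM^{\dagger}),$$ where $M=M(X_1,\dots,X_U)$ is the $Un\times k$ matrix obtained by stacking $X_1,\dots,X_U$ vertically (rows of $X_1$ first, then those of $X_2$, etc.), and write $\mathfrak{D}(N)=\mathfrak{D}(N,\dots,N)$. Then there is a constant $K>0$, depending on the lattices $\mathbf{L}_1,\dots,\mathbf{L}_U$ (and on $n,k,U$) but not on $N_1,\dots,N_U$, such that for all positive integers $N_1,\dots,N_U$, $$\mathfrak{D}(N_1,\dots,N_U)\le K\prod_{l=1}^{U-1}N_l^{-\frac{2n^2(U-l)}{k-n(U-l)}},$$ and in particular $\mathfrak{D}(N)\le K/N^{\alpha}$ with $\alpha=\sum_{l=1}^{U-1}\frac{2n^2(U-l)}{k-n(U-l)}$. In the special case $k=Un$ this reads $$\mathfrak{D}(N_1,\dots,N_U)\le K\prod_{l=1}^{U-1}N_l^{-\frac{2n(U-l)}{l}},\qquad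 \mathfrak{D}(N)\le \frac{K}{N^{\beta}},\quad \beta=\sum_{l=1}^{U-1}\frac{2n(U-l)}{l}.$$
   Context: $M_{n\times k}(\mathbb{C})$ is the space of complex $n\times k$ matrices, regarded as a real vector space of dimension $2nk$. For a complex matrix $X$, $X^{\dagger}$ denotes its conjugate transpose. The tuple $(\mathbf{L}_1(N_1),\dots,\mathbf{L}_U(N_U))$ is called a $U$-user MIMO-MAC lattice code and $\mathfrak{D}$ its decay function. *)

(* Defs.v *)
(* Complex scalars: an arbitrary numClosedFieldType C
   (an algebraically closed field with conjugation and the induced order,
   the MathComp abstraction of the complex numbers); real scalars are the
   elements x with x \is Num.real. *)
From HB Require Import structures.
From mathcomp Require Import all_boot all_order all_algebra all_field.
Set Implicit Arguments. Unset Strict Implicit. Unset Printing Implicit Defensive.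
Import Order.TTheory GRing.Theory Num.Theory.
Local Open Scope ring_scope.

Definition ctrmx (C : numClosedFieldType) (m p : nat) (A : 'M[C]_(m, p)) : 'M[C]_(p, m) :=
  (map_mx Num.conj A)^T.

Definition real_lin_indep (C : numClosedFieldType) (m p r : nat)
  (B : 'I_r -> 'M[C]_(m, p)) : Prop :=
  forall a : 'I_r -> C, (forall i, a i \is Num.real) ->
    \sum_(i < r) a i *: B i = 0 -> forall i, a i = 0.

Definition in_box (C : numClosedFieldType) (m p r : nat)
  (B : 'I_r -> 'M[C]_(m, p)) (N : nat) (X : 'M[C]_(m, p)) : Prop :=
  exists b : 'I_r -> int, (forall i, (absz (b i) <= N)%N) /\
    X = \sum_(i < r) (b i)%:~R *: B i.

Definition stack (C : numClosedFieldType) (U n k : nat) (X : 'I_U -> 'M[C]_(n, k)) :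
  'M[C]_(\sum_(j < U) n, k) := \mxcol_(j < U) X j.

Definition gram_det (C : numClosedFieldType) (U n k : nat) (X : 'I_U -> 'M[C]_(n, k)) : C :=
  \det (stack X *m ctrmx (stack X)).

Definition is_decay (C : numClosedFieldType) (U n k r : nat)
  (B : 'I_U -> 'I_r -> 'M[C]_(n, k)) (N : 'I_U -> nat) (d : C) : Prop :=
  (exists X : 'I_U -> 'M[C]_(n, k),
      (forall j, X j != 0 /\ in_box (B j) (N j) (X j)) /\ d = gram_det X) /\
  (forall X : 'I_U -> 'M[C]_(n, k),
      (forall j, X j != 0 /\ in_box (B j) (N j) (X j)) -> d <= gram_det X).

(* x^e for a rational exponent e (x a positive real):
   the denominator-th (nonnegative real) root of x^(numerator) *)
Definition ratpow (C : numClosedFieldType) (x : C) (e : rat) : C :=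
  (absz (denq e)).-root (x ^ numq e).

(* exponent 2 n^2 (U - l) / (k - n (U - l)) for the 1-based user l = l0 + 1,
   where l0 : 'I_U is the 0-based index *)
Definition expo (U n k l0 : nat) : rat :=
  (2 * n ^ 2 * (U - l0.+1))%N%:R / (k - n * (U - l0.+1))%N%:R.

(* Main.v *)
(* The codewords are chosen from the last user to the first. Let A be the stack
   of the a = n(U-l) rows chosen so far and p = k - a. If the rows of A are
   dependent, the Gram determinant vanishes whatever is put on top of A.
   Otherwise let S have as rows an orthonormal basis of the orthogonal
   complement of A; then stacking X on A multiplies the Gram determinant by that
   of P = X S^H, an n x p matrix (^H is the conjugate transpose). The
   (N+1)^(2kn) points with coefficients in [0, N] map to vectors of size O(N) in
   real dimension 2np, so by the pigeonhole principle two of them differ by some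
   X for which the entries of P are O(N^(1 - k/p)) = O(N^(-a/p)), and the Gram
   determinant of P is then O(N^(-2na/p)). *)
Require Import Defs.
From HB Require Import structures.
From mathcomp Require Import all_boot all_order all_fingroup all_algebra all_field.
Set Implicit Arguments. Unset Strict Implicit. Unset Printing Implicit Defensive.
Import Order.TTheory GRing.Theory Num.Theory.
Local Open Scope ring_scope.

(** * Laws of rational powers *)

Section RationalPowers.
Variables (C : numClosedFieldType) (x : C).
Hypothesis x_gt0 : 0 < x.

Lemma ratpow_gt0 (e : rat) : 0 < ratpow x e.
Proof. by rewrite /ratpow rootC_gt0 ?absz_gt0 ?denq_neq0 // exprz_gt0. Qed.

(** The fraction p/q may be unreduced. This gives the laws below: raise both sides to a common
    multiple of the denominators, then use that powers are injective on nonnegative elements. *)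
Lemma ratpow_expn (e : rat) (p : int) (q : nat) :
  e * q%:R = p%:~R -> ratpow x e ^+ q = x ^ p.
Proof.
move=> eqp; set D := absz (denq e).
have D_gt0 : (0 < D)%N by rewrite absz_gt0 denq_neq0.
apply/eqP; rewrite -(eqrXn2 D_gt0); last 2 first.
- exact: exprn_ge0 (ltW (ratpow_gt0 e)).
- by rewrite ltW ?exprz_gt0.
rewrite -exprM mulnC exprM /ratpow rootCK // !exprnP !exprz_exp.
suff -> : numq e * q%:Z = p * D%:Z by [].
have DE : D%:Z = denq e by rewrite gez0_abs ?denq_ge0.
apply/eqP; rewrite -(@eqr_int rat) !intrM -eqp DE.
by rewrite numqE mulrAC.
Qed.

Lemma ratpowN (e : rat) : ratpow x (- e) = (ratpow x e)^-1.
Proof.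
by rewrite /ratpow denqN numqN -rootCV ?exprz_ge0 ?(ltW x_gt0) // invr_expz.
Qed.

Lemma ratpowD (e f : rat) : ratpow x (e + f) = ratpow x e * ratpow x f.
Proof.
pose a := absz (denq e); pose b := absz (denq f).
have ab_gt0 : (0 < a * b)%N by rewrite muln_gt0 !absz_gt0 !denq_neq0.
have nume : e * a%:R = (numq e)%:~R.
  by rewrite -[a%:R]/(a%:Z%:~R) gez0_abs ?denq_ge0 // numqE.
have numf : f * b%:R = (numq f)%:~R.
  by rewrite -[b%:R]/(b%:Z%:~R) gez0_abs ?denq_ge0 // numqE.
apply/eqP; rewrite -(eqrXn2 ab_gt0) ?mulr_ge0 ?ltW ?ratpow_gt0 // exprMn.
have He : e * (a * b)%:R = (numq e * b%:Z)%:~R by rewrite intrM natrM mulrA nume.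
have Hf : f * (a * b)%:R = (numq f * a%:Z)%:~R.
  by rewrite intrM natrM mulrCA numf mulrC.
rewrite (@ratpow_expn _ (numq e * b%:Z + numq f * a%:Z)); last first.
  by rewrite mulrDl He Hf intrD.
by rewrite (ratpow_expn He) (ratpow_expn Hf) expfzDr ?eqxx ?gt_eqF.
Qed.

Lemma ratpow0 : ratpow x 0 = 1.
Proof. by have := @ratpow_expn 0 0 1; rewrite mul0r expr0z expr1; apply. Qed.

Lemma ratpow_sum (I : Type) (s : seq I) (P : pred I) (F : I -> rat) :
  ratpow x (\sum_(i <- s | P i) F i) = \prod_(i <- s | P i) ratpow x (F i).
Proof. exact: (big_morph _ ratpowD ratpow0). Qed.

(** The bridge from the counting argument, which only involves integer powers, to the rational
    exponents of the final bound. *)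
Lemma le_ratpowN (y c : C) (m p : nat) : (0 < p)%N -> 0 <= y -> 0 <= c ->
  y ^+ p * x ^+ m <= c ^+ p -> y <= c * ratpow x (- (m%:R / p%:R)).
Proof.
move=> p_gt0 y_ge0 c_ge0 le_yc.
have pow_ge0 := ltW (ratpow_gt0 (- (m%:R / p%:R))).
rewrite -(ler_pXn2r p_gt0) ?nnegrE ?mulr_ge0 // exprMn.
rewrite (@ratpow_expn _ (- m%:Z)); last first.
  by rewrite mulNr divfK ?pnatr_eq0 -?lt0n // intrN.
by rewrite -exprnN ler_pdivlMr ?exprn_gt0.
Qed.

End RationalPowers.

(** * Gram determinants and orthogonal projection *)

Section Gram.
Variable C : numClosedFieldType.

Lemma ctrmxM m n p (A : 'M[C]_(m, n)) (B : 'M_(n, p)) :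
  ctrmx (A *m B) = ctrmx B *m ctrmx A.
Proof. by rewrite /ctrmx map_mxM trmx_mul. Qed.

Lemma ctrmxK m n : cancel (@ctrmx C m n) (@ctrmx C n m).
Proof. by move=> A; apply/matrixP=> i j; rewrite !mxE conjCK. Qed.

Lemma ctrmx0 m n : ctrmx (0 : 'M[C]_(m, n)) = 0.
Proof. by rewrite /ctrmx map_mx0 trmx0. Qed.

Lemma det_gram_real m n (A : 'M[C]_(m, n)) : \det (A *m ctrmx A) \is Num.real.
Proof. by rewrite CrealE -det_map_mx -det_tr -/(ctrmx _) ctrmxM ctrmxK. Qed.

Lemma det_gram_mull m n (L : 'M[C]_m) (A : 'M[C]_(m, n)) :
  \det (L *m A *m ctrmx (L *m A)) = \det L * Num.conj (\det L) * \det (A *m ctrmx A).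
Proof.
rewrite ctrmxM mulmxA -(mulmxA L) !det_mulmx /ctrmx det_tr det_map_mx.
by rewrite mulrAC.
Qed.

Lemma det_gram_not_free m n (A : 'M[C]_(m, n)) :
  ~~ row_free A -> \det (A *m ctrmx A) = 0.
Proof.
move=> nfA; apply/eqP; apply: contraR nfA => dA.
have := mxrankM_maxl A (ctrmx A); rewrite mxrank_unit ?unitmxE ?unitfE //.
by rewrite /row_free eqn_leq rank_leq_row.
Qed.

(** Gram-Schmidt applied to a basis of the orthogonal complement, which has rank k - a = p. The rows
    of [A] and [S] span the whole space, and multiplying by [ctrmx S] reads off the coordinates
    along [S]. *)
Lemma orthonormal_complement a p k (A : 'M[C]_(a, k)) :
  row_free A -> (a + p = k)%N ->
  exists S : 'M[C]_(p, k), [/\ S *m ctrmx S = 1%:M, A *m ctrmx S = 0 &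
    forall n (X : 'M_(n, k)), exists Q, X = X *m ctrmx S *m S + Q *m A].
Proof.
move=> /eqP rA apk.
pose O := orthomx Num.conj (mx_of_hermitian (hermitian1mx k)) A.
have rO : \rank O = p by rewrite rank_ortho rA -apk addKn.
have [G OG Gfree] : exists2 G : 'M[C]_(p, k), (G :=: O)%MS & row_free G.
  by rewrite -rO; exists (row_base O); [exact: eq_row_base | exact: row_base_free].
have SG := eqmx_trans (eqmx_schmidt_free Gfree) OG.
pose S := schmidt G; have le_pk : (p <= k)%N by rewrite -apk leq_addl.
have SS : S *m ctrmx S = 1%:M.
  by rewrite /ctrmx map_trmx; apply/unitarymxP/schmidt_unitarymx.
have SA : S *m ctrmx A = 0.
  by rewrite /ctrmx map_trmx; apply/orthomx1P; rewrite SG.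
have AS : A *m ctrmx S = 0 by rewrite -[A]ctrmxK -ctrmxM SA ctrmx0.
exists S; split=> // n X.
have /sub_addsmxP[[Q P] /= XE] : (X <= A + S)%MS.
  by rewrite (adds_eqmx (eqmx_refl A) SG) addsmx_ortho submx1.
exists Q; rewrite [in RHS]XE mulmxDl -!mulmxA AS SS !mulmx0 add0r mulmx1 addrC.
by rewrite {1}XE.
Qed.

(** A row operation of determinant 1 takes [Q *m A] off [X] and leaves [P *m S], whose rows are
    orthogonal to those of [A]; an off-diagonal block of the Gram matrix then vanishes. *)
Lemma det_gram_col_mx n a p k (X : 'M[C]_(n, k)) (A : 'M[C]_(a, k))
    (S : 'M[C]_(p, k)) (Q : 'M[C]_(n, a)) :
  S *m ctrmx S = 1%:M -> A *m ctrmx S = 0 -> X = X *m ctrmx S *m S + Q *m A ->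
  \det (col_mx X A *m ctrmx (col_mx X A)) =
    \det (X *m ctrmx S *m ctrmx (X *m ctrmx S)) * \det (A *m ctrmx A).
Proof.
set P := X *m ctrmx S => SS AS XE.
have SA : S *m ctrmx A = 0 by rewrite -[S]ctrmxK -ctrmxM AS ctrmx0.
have -> : col_mx X A = block_mx 1%:M Q 0 1%:M *m col_mx (P *m S) A.
  by rewrite mul_block_col !mul1mx mul0mx add0r -XE.
rewrite det_gram_mull det_ublock !det1 mulr1 rmorph1 !mul1r.
rewrite /ctrmx map_col_mx tr_col_mx mul_col_row -!/(ctrmx _).
rewrite (_ : P *m S *m _ = P *m ctrmx P); last first.
  by rewrite ctrmxM mulmxA -(mulmxA P) SS mulmx1.
by rewrite -[X in block_mx _ X _ _]mulmxA SA mulmx0 det_lblock.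
Qed.

(** Leibniz expansion: each of the n! terms is, up to sign, a product of n Gram entries, and each
    entry is a sum of p products of norm at most eps^2. *)
Lemma norm_det_gram_le n p (Z : 'M[C]_(n, p)) (eps : C) :
  (forall i j, `|Z i j| <= eps) ->
  `|\det (Z *m ctrmx Z)| <= n`!%:R * (p%:R * eps ^+ 2) ^+ n.
Proof.
move=> leZ; apply: le_trans (ler_norm_sum _ _ _) _.
have -> : n`!%:R * (p%:R * eps ^+ 2) ^+ n = \sum_(s : 'S_n) (p%:R * eps ^+ 2) ^+ n.
  by rewrite sumr_const card_Sn mulr_natl.
apply: ler_sum => s _; rewrite normrM normrX normrN1 expr1n mul1r normr_prod.
rewrite -[n in leRHS]card_ord -prodr_const; apply: ler_prod => i _.
rewrite normr_ge0 mxE (le_trans (ler_norm_sum _ _ _)) //.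
rewrite -[p in leRHS]card_ord mulr_natl -sumr_const; apply: ler_sum => j _.
by rewrite !mxE normrM norm_conjC expr2 ler_pM.
Qed.

End Gram.

(** * The pigeonhole principle in a real box *)

Section Pigeonhole.
Variable C : numClosedFieldType.

(* The order on C need not be archimedean, so the bin is found by induction
   on the number of bins rather than with a floor function. *)
Lemma real_bin (t : nat) (y : C) : y \is Num.real -> 0 <= y <= t.+1%:R ->
  exists i : 'I_t.+1, i%:R <= y <= i.+1%:R.
Proof.
move=> y_real; elim: t => [|t IHt] /andP[y_ge0 y_le].
  by exists ord0; rewrite y_ge0 y_le.
have [yt|ty] := real_leP y_real (realn _ t.+1).
  have [|i le_iy] := IHt; first by rewrite y_ge0.
  by exists (widen_ord (leqnSn _) i).
by exists ord_max; rewrite ltW.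
Qed.

(** Each side [-M, M] is rescaled to [0, T] and cut into T unit bins. Two of the points share a bin
    in every coordinate, so their rescaled coordinates differ by at most 1. *)
Lemma box_pigeonhole (I J : finType) (F : I -> J -> C) (M : C) (T : nat) :
  0 < M -> (forall i j, F i j \is Num.real) -> (forall i j, `|F i j| <= M) ->
  (0 < T)%N -> (T ^ #|J| < #|I|)%N ->
  exists i1 i2, i1 != i2 /\ forall j, `|F i1 j - F i2 j| <= 2 * M / T%:R.
Proof.
move=> M_gt0 F_real F_le; case: T => // t _ ltJI.
pose y i j := (F i j + M) * (t.+1%:R / (2 * M)).
have s_gt0 : 0 < t.+1%:R / (2 * M) :> C by rewrite divr_gt0 ?mulr_gt0 ?ltr0n.
have y_real i j : y i j \is Num.real.
  by rewrite realM ?realD ?F_real ?gtr0_real.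
have bin i j : exists b : 'I_t.+1, b%:R <= y i j <= b.+1%:R.
  have := F_le i j; rewrite real_ler_norml // => /andP[leMF leFM].
  apply: real_bin => //.
  rewrite /y mulr_ge0 ?(ltW s_gt0) -?lerBlDr ?sub0r //=.
  rewrite mulrA ler_pdivrMr ?mulr_gt0 ?ltr0n // mulrC ler_pM2l ?ltr0n //.
  by rewrite mulr_natl mulr2n lerD2r.
pose f i : {ffun J -> 'I_t.+1} := [ffun j => xchoose (bin i j)].
have /injectivePn[i1 [i2 ne12 ff]] : ~~ injectiveb f.
  apply/injectiveP => /leq_card; rewrite card_ffun card_ord leqNgt.
  by rewrite ltJI.
exists i1, i2; split=> [//|j].
have /andP[l1 r1] := xchooseP (bin i1 j); have /andP[l2 r2] := xchooseP (bin i2 j).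
have eb : xchoose (bin i1 j) = xchoose (bin i2 j).
  by have := congr1 (fun g : {ffun _} => g j) ff; rewrite !ffunE.
rewrite -eb in l2 r2; set b := xchoose _ in l1 r1 l2 r2.
have -> : 2 * M / t.+1%:R = (t.+1%:R / (2 * M))^-1 by rewrite invf_div.
rewrite -(ler_pM2r s_gt0) mulVf ?gt_eqF // -{1}(gtr0_norm s_gt0) -normrM.
have -> : (F i1 j - F i2 j) * (t.+1%:R / (2 * M)) = y i1 j - y i2 j.
  by rewrite /y -mulrBl opprD addrACA subrr addr0.
rewrite real_ler_norml ?realB //.
rewrite lerBlDr lerBrDr; apply/andP; split.
  by rewrite (le_trans _ l1) // addrC lerBlDr natr1.
by rewrite (le_trans r1) // -natr1 addrC lerD2l.
Qed.

End Pigeonhole.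

(** * Lattice points with small projection *)

Section SmallProjection.
Variable C : numClosedFieldType.

Lemma norm_orthonormal_le1 p k (S : 'M[C]_(p, k)) y z :
  S *m ctrmx S = 1%:M -> `|S y z| <= 1.
Proof.
move=> /matrixP/(_ y y); rewrite !mxE eqxx => SE.
rewrite -(@expr_le1 _ 2) // -[leRHS]SE (bigD1 z) //= !mxE -normCK.
by rewrite lerDl sumr_ge0 // => i _; rewrite !mxE -normCK exprn_ge0.
Qed.

Lemma norm_le_ReIm (z : C) : `|z| <= `|'Re z| + `|'Im z|.
Proof.
by rewrite [in leLHS](Crect z) (le_trans (ler_normD _ _)) // normrM normCi mul1r.
Qed.

Lemma norm_Im_le (z : C) : `|'Im z| <= `|z|.
Proof.
rewrite -(@ler_pXn2r _ 2) ?nnegrE // [leRHS]normC2_Re_Im real_normK ?Creal_Im //.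
by rewrite lerDr -real_normK ?Creal_Re ?exprn_ge0.
Qed.

(** Supplies the number of bins per coordinate: the strict bound feeds the pigeonhole principle, and
    the last one keeps T comparable to the p-th root of m. *)
Lemma max_root_exists p m : (0 < p)%N -> (1 < m)%N ->
  exists T, [/\ (0 < T)%N, (T ^ p < m)%N & (m <= T.+1 ^ p)%N].
Proof.
move=> p_gt0 m_gt1; have exP : exists t, (t ^ p < m)%N by exists 1%N; rewrite exp1n.
have ubP t : (t ^ p < m)%N -> (t <= m)%N.
  by case: t => // t /ltnW; apply: leq_trans; rewrite -{1}[t.+1]expn1 leq_pexp2l.
case: (ex_maxnP exP ubP) => T ltT maxT; exists T; split => //.
  by apply: maxT; rewrite exp1n.
by rewrite leqNgt; apply/negP => /maxT; rewrite ltnn.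
Qed.

Lemma real_lin_indep_int m p r (B : 'I_r -> 'M[C]_(m, p)) (b : 'I_r -> int) i :
  real_lin_indep B -> b i != 0 -> \sum_(i < r) (b i)%:~R *: B i != 0.
Proof.
move=> hB; apply: contraNneq => /hB hb; rewrite -(@intr_eq0 C).
by rewrite hb // => j; apply: realz.
Qed.

Lemma box_nonzero m p r (B : 'I_r -> 'M[C]_(m, p)) (N : nat) :
  (0 < r)%N -> (0 < N)%N -> real_lin_indep B -> exists2 X, X != 0 & in_box B N X.
Proof.
case: r B => // r B _ N_gt0 hB; pose b (i : 'I_r.+1) : int := (i == ord0)%:Z.
exists (\sum_i (b i)%:~R *: B i); first exact: (@real_lin_indep_int _ _ _ _ _ ord0).
by exists b; split=> // i; rewrite /b; case: eqP.
Qed.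

(** The constant is chosen before [S], which later depends on the codewords of the other users and
    hence on their box sizes. *)
Lemma small_projection n a p k (B : 'I_(2 * k * n) -> 'M[C]_(n, k)) :
  (0 < n)%N -> (0 < p)%N -> (a + p = k)%N -> real_lin_indep B ->
  exists c : C, 0 < c /\ forall (S : 'M[C]_(p, k)) (N : nat),
    S *m ctrmx S = 1%:M -> (0 < N)%N ->
    exists (X : 'M[C]_(n, k)) (eps : C), [/\ X != 0, in_box B N X, 0 <= eps,
      forall x y, `|(X *m ctrmx S) x y| <= eps & eps ^+ p * N%:R ^+ a <= c ^+ p].
Proof.
move=> n_gt0 p_gt0 apk hB.
pose c0 : C := 1 + \sum_x \sum_z \sum_i `|B i x z|.
have row_le x : \sum_z \sum_i `|B i x z| <= c0.
  rewrite /c0 (bigD1 x) //= addrCA lerDl addr_ge0 ?sumr_ge0 // => x' _.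
  by do 2![rewrite sumr_ge0 // => ? _].
have c0_gt0 : 0 < c0.
  by rewrite ltr_wpDr // !sumr_ge0 // => ? _; do 2![rewrite sumr_ge0 // => ? _].
(* The 8 collects 2 from the bin width 2M/T, 2 from adding real and imaginary parts, and 2 from T +
   1 <= 2T. *)
exists (8 * c0); split=> [|S N SS N_gt0]; first by rewrite mulr_gt0.
have k_gt0 : (0 < k)%N by rewrite -apk addn_gt0 p_gt0 orbT.
have [|T [T_gt0 ltT geT]] := @max_root_exists p (N.+1 ^ k) p_gt0.
  by rewrite -(exp1n k) ltn_exp2r.
pose L (b : {ffun 'I_(2 * k * n) -> 'I_N.+1}) := \sum_i (b i)%:R *: B i.
pose M : C := N%:R * c0.
have L_le b x y : `|(L b *m ctrmx S) x y| <= M.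
  rewrite mxE (le_trans (ler_norm_sum _ _ _)) //.
  apply: le_trans (ler_wpM2l (ler0n _ N) (row_le x)); rewrite mulr_sumr.
  apply: ler_sum => z _; rewrite normrM !mxE norm_conjC.
  apply: le_trans (ler_piMr _ (norm_orthonormal_le1 y z SS)) _ => //.
  rewrite summxE (le_trans (ler_norm_sum _ _ _)) // mulr_sumr.
  apply: ler_sum => i _; rewrite mxE normrM normr_nat ler_wpM2r //.
  by rewrite ler_nat -ltnS ltn_ord.
pose F b (j : 'I_n * 'I_p * bool) : C := let z := (L b *m ctrmx S) j.1.1 j.1.2 in
  if j.2 then 'Re z else 'Im z.
have M_gt0 : 0 < M by rewrite mulr_gt0 ?ltr0n.
have [b1 [b2 [ne12 leF]]] : exists b1 b2, b1 != b2 /\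
    forall j, `|F b1 j - F b2 j| <= 2 * M / T%:R.
  apply: box_pigeonhole => // [b j|b j|].
  - by rewrite /F; case: ifP => _; rewrite ?Creal_Re ?Creal_Im.
  - apply: le_trans (L_le b j.1.1 j.1.2); rewrite /F; set z := (_ *m _) _ _.
    by case: ifP => _; rewrite ?leif_normC_Re_Creal ?norm_Im_le.
  (* The T^(2np) bins and (N+1)^(2kn) points are the 2n-th powers of the two sides of [ltT]. *)
  rewrite !card_prod !card_ord card_bool card_ffun !card_ord.
  rewrite (mulnAC n) mulnC (mulnC n) (mulnC 2%N k) -mulnA (expnM _ p) (expnM _ k).
  by rewrite ltn_exp2r // muln_gt0.
pose b i : int := (b1 i)%:Z - (b2 i)%:Z.
pose X := \sum_i (b i)%:~R *: B i.
have XE : X = L b1 - L b2.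
  rewrite /X /L -sumrB; apply: eq_bigr => i _.
  by rewrite -scalerBl /b rmorphB.
have eps_ge0 : 0 <= 4 * M / T%:R by rewrite divr_ge0 // mulr_ge0 // ltW.
exists X, (4 * M / T%:R); split.
- have [i ne_i] : exists i, b1 i != b2 i.
    apply/existsP; apply: contraR ne12 => /existsPn eq12.
    by apply/eqP/ffunP => i; apply/eqP; move: (eq12 i); rewrite negbK.
  by apply: (@real_lin_indep_int _ _ _ _ _ i) => //; rewrite subr_eq0.
- exists b; split=> // i; rewrite /b.
  case: (leqP (b1 i) (b2 i)) => le12.
    by rewrite distnEr // (leq_trans (leq_subr _ _)) // -ltnS ltn_ord.
  by rewrite distnEl ?(ltnW le12) // (leq_trans (leq_subr _ _)) // -ltnS ltn_ord.
- exact: eps_ge0.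
- move=> x y; apply: le_trans (norm_le_ReIm _) _.
  have -> : (X *m ctrmx S) x y = (L b1 *m ctrmx S) x y - (L b2 *m ctrmx S) x y.
    by rewrite XE mulmxBl !mxE.
  have -> : 4 * M / T%:R = 2 * M / T%:R + 2 * M / T%:R.
    by rewrite -!mulrDl -natrD.
  rewrite !raddfB lerD //; first exact: (leF (x, y, true)).
  exact: (leF (x, y, false)).
have leN : (N%:R ^+ k <= (2 * T%:R) ^+ p :> C).
  rewrite -natrM -!natrX ler_nat (leq_trans _ (leq_trans geT _)) //.
    by rewrite leq_exp2r.
  by rewrite leq_exp2r // mul2n -addnn -addn1 leq_add2l.
(* Multiplied by N^p, the left side becomes eps^p N^k because a + p = k. Now [leN] applies, and eps
   * 2T = 8 c0 N. *)
have Np_gt0 : 0 < N%:R ^+ p :> C by rewrite exprn_gt0 ?ltr0n.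
rewrite -(ler_pM2r Np_gt0) -[leLHS]mulrA -exprD apk.
apply: le_trans (ler_wpM2l _ leN) _; first exact: exprn_ge0.
rewrite -!exprMn /M (_ : 4 * (N%:R * c0) / T%:R * (2 * T%:R) = 8 * c0 * N%:R) //.
rewrite [LHS]mulrCA divfK ?pnatr_eq0 -?lt0n //.
by rewrite (mulrC N%:R) !mulrA -natrM.
Qed.

Lemma det_gram_projection_le n a p k (B : 'I_(2 * k * n) -> 'M[C]_(n, k)) :
  (0 < n)%N -> (0 < p)%N -> (a + p = k)%N -> real_lin_indep B ->
  exists c : C, 0 < c /\ forall (S : 'M[C]_(p, k)) (N : nat),
    S *m ctrmx S = 1%:M -> (0 < N)%N ->
    exists X : 'M[C]_(n, k), [/\ X != 0, in_box B N X &
      `|\det (X *m ctrmx S *m ctrmx (X *m ctrmx S))| <=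
        c * ratpow N%:R (- ((2 * n * a)%:R / p%:R))].
Proof.
move=> n_gt0 p_gt0 apk hB.
have [c0 [c0_gt0 small]] := small_projection n_gt0 p_gt0 apk hB.
exists (n`!%:R * (p%:R * c0 ^+ 2) ^+ n); split=> [|S N SS N_gt0].
  by rewrite mulr_gt0 ?ltr0n ?fact_gt0 // exprn_gt0 // mulr_gt0 ?ltr0n ?exprn_gt0.
have [X [eps [nzX boxX eps_ge0 le_eps le_c]]] := small S N SS N_gt0.
exists X; split=> //; apply: le_trans (norm_det_gram_le le_eps) _.
apply: le_ratpowN => //; rewrite ?ltr0n //.
- by rewrite mulr_ge0 ?exprn_ge0 ?mulr_ge0 ?exprn_ge0 ?ler0n.
- by rewrite mulr_ge0 ?exprn_ge0 ?mulr_ge0 ?exprn_ge0 ?ler0n ?ltW.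
(* The bound is homogeneous of degree 2n in t, so its p-th power depends on t only through t^p, the
   quantity that [le_c] controls. *)
have powE (t : C) : (n`!%:R * (p%:R * t ^+ 2) ^+ n) ^+ p =
    (n`!%:R * p%:R ^+ n) ^+ p * t ^+ p ^+ (2 * n).
  by rewrite (exprMn n) mulrA exprMn -!exprM mulnA (mulnC p).
rewrite !powE -mulrA ler_wpM2l ?exprn_ge0 ?mulr_ge0 ?exprn_ge0 ?ler0n //.
rewrite (mulnC _ a) (exprM N%:R) -exprMn lerXn2r // nnegrE.
- by rewrite mulr_ge0 ?exprn_ge0.
- by rewrite exprn_ge0 ?ltW.
Qed.

End SmallProjection.

(** * Induction on the number of users *)

Lemma gram_det_recl (C : numClosedFieldType) U n k (X : 'I_U.+1 -> 'M[C]_(n, k)) :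
  let M := col_mx (X ord0) (stack (fun j => X (lift ord0 j))) in
  gram_det X = \det (M *m ctrmx M).
Proof.
rewrite /gram_det /stack mxcol_recu /=.
(* The cast relates two forms of the row count that [big_ord_recl] makes identical. *)
by move: mxsize_recl; rewrite big_ord_recl => e; rewrite castmx_id.
Qed.

Lemma exists_small_gram_det (C : numClosedFieldType) (U n k : nat)
    (B : 'I_U -> 'I_(2 * k * n) -> 'M[C]_(n, k)) :
  (0 < n)%N -> (U * n <= k)%N -> (forall j, real_lin_indep (B j)) ->
  exists K : C, 0 < K /\ forall N : 'I_U -> nat, (forall j, (0 < N j)%N) ->
    exists X : 'I_U -> 'M[C]_(n, k),
      (forall j, X j != 0 /\ in_box (B j) (N j) (X j)) /\
      `|gram_det X| <= K * \prod_(l < U) ratpow (N l)%:R (- expo U n k l).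
Proof.
elim: U B => [|U IHU] B n_gt0 leUk hB.
  exists 1; split=> // N _; exists (fun _ => 0); split=> [[]//|].
  (* Without users the Gram matrix is 0 x 0, of determinant 1. *)
  rewrite big_ord0 /gram_det; move: (stack _); rewrite big_ord0 => A.
  by rewrite det_mx00 normr1 mulr1.
have leU'k : (U * n <= k)%N by rewrite (leq_trans _ leUk) // leq_mul2r leqnSn orbT.
have [K [K_gt0 HK]] := IHU (fun j => B (lift ord0 j)) n_gt0 leU'k (fun j => hB _).
pose a := (\sum_(j < U) n)%N; have aE : a = (n * U)%N.
  by rewrite /a sum_nat_const card_ord mulnC.
pose p := (k - a)%N.
have p_gt0 : (0 < p)%N.
  by rewrite subn_gt0 aE mulnC (leq_trans _ leUk) // mulSn -{1}[(U * n)%N]add0n ltn_add2r.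
have apk : (a + p = k)%N by rewrite subnKC // aE mulnC.
have [c [c_gt0 Hc]] := det_gram_projection_le n_gt0 p_gt0 apk (hB ord0).
exists (c * K); split=> [|N N_gt0]; first exact: mulr_gt0.
have [Y [boxY leY]] := HK (fun j => N (lift ord0 j)) (fun j => N_gt0 _).
pose cons0 X j := oapp Y X (unlift ord0 j).
have cons0_box X : X != 0 -> in_box (B ord0) (N ord0) X ->
    forall j, cons0 X j != 0 /\ in_box (B j) (N j) (cons0 X j).
  by move=> nzX boxX j; rewrite /cons0; case: unliftP => [i ->|->] /=; [exact: boxY|].
have gramE X : gram_det (cons0 X) = let M := col_mx X (stack Y) in \det (M *m ctrmx M).
  rewrite gram_det_recl /cons0 unlift_none /=.
  suff -> : stack (fun j => oapp Y X (unlift ord0 (lift ord0 j))) = stack Y by [].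
  by apply/eq_mxcol => j; rewrite liftK.
rewrite big_ord_recl.
(* An exponent depends only on the number of users after l, so dropping the first user and
   reindexing leaves it unchanged. *)
have -> : \prod_(l < U) ratpow (N (lift ord0 l))%:R (- expo U.+1 n k (lift ord0 l)) =
    \prod_(l < U) ratpow (N (lift ord0 l))%:R (- expo U n k l) :> C by [].
have expoE : expo U.+1 n k 0 = (2 * n * a)%:R / p%:R.
  by rewrite /expo subSS subn0 /p aE -mulnn !mulnA.
have pow_ge0 j e : 0 <= ratpow (N j)%:R e :> C by rewrite ltW ?ratpow_gt0 ?ltr0n.
have [freeY|nfreeY] := boolP (row_free (stack Y)).
  have [S [SS AS decomp]] := orthonormal_complement freeY apk.
  have [X [nzX boxX leX]] := Hc S (N ord0) SS (N_gt0 _).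
  exists (cons0 X); split; first exact: cons0_box.
  have [Q XE] := decomp _ X.
  rewrite gramE /= (det_gram_col_mx SS AS XE) normrM mulrACA expoE.
  exact: ler_pM.
(* Dependent rows: any nonzero point of the first box will do. *)
have [|X nzX boxX] := box_nonzero _ (N_gt0 ord0) (hB ord0).
  by rewrite !muln_gt0 /= n_gt0 andbT -apk addn_gt0 p_gt0 orbT.
exists (cons0 X); split; first exact: cons0_box.
rewrite gramE /= det_gram_not_free ?normr0.
  by rewrite mulr_ge0 ?(ltW (mulr_gt0 c_gt0 K_gt0)) ?mulr_ge0 ?prodr_ge0.
(* The last columns of a right inverse of the whole stack form a right inverse of [stack Y]. *)
apply: contra nfreeY => /row_freeP[R]; rewrite mul_col_mx => colR.
apply/row_freeP; exists (rsubmx R).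
rewrite mulmx_rsub -[stack Y *m R](col_mxKd (X *m R)) colR scalar_mx_block.
exact: block_mxKdr.
Qed.

Theorem theorem2p3 (C : numClosedFieldType) (U n k : nat)
  (hU : (1 <= U)%N) (hn : (1 <= n)%N) (hk : (U * n <= k)%N)
  (B : 'I_U -> 'I_(2 * k * n) -> 'M[C]_(n, k))
  (hB : forall j, real_lin_indep (B j)) :
  exists K : C, 0 < K /\
    (forall (N : 'I_U -> nat), (forall j, (0 < N j)%N) ->
      forall d, is_decay B N d ->
        d <= K * \prod_(l < U | (l.+1 < U)%N) ratpow (N l)%:R (- expo U n k l)) /\
    (forall (N : nat), (0 < N)%N ->
      forall d, is_decay B (fun _ => N) d ->
        d <= K / ratpow N%:R (\sum_(l < U | (l.+1 < U)%N) expo U n k l)).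
Proof.
have [K [K_gt0 HK]] := exists_small_gram_det hn hk hB.
have decay_le (N : 'I_U -> nat) : (forall j, (0 < N j)%N) -> forall d, is_decay B N d ->
    d <= K * \prod_(l < U | (l.+1 < U)%N) ratpow (N l)%:R (- expo U n k l).
  move=> N_gt0 d [_ min_d]; have [X [boxX leX]] := HK N N_gt0.
  apply: le_trans (min_d X boxX) _; rewrite big_mkcond /=.
  apply: le_trans (real_ler_norm (det_gram_real _)) _; apply: le_trans leX _.
  rewrite le_eqVlt; apply/orP; left; apply/eqP; congr (_ * _).
  apply: eq_bigr => l _; case: ifPn => //; rewrite -leqNgt => leUl.
  (* The last user has exponent 0 and contributes a factor 1, so including it in the product changes
     nothing. *)
  have -> : expo U n k l = 0 by rewrite /expo (eqP leUl) muln0 mul0r.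
  by rewrite oppr0 ratpow0 ?ltr0n.
exists K; split=> //; split=> // N N_gt0 d /(decay_le _ (fun _ => N_gt0)).
have N_gt0C : 0 < N%:R :> C by rewrite ltr0n.
by rewrite -ratpowN // -sumrN ratpow_sum.
Qed.
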